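(* Let $a,b$ be complex numbers, let $f_3(z,a,b)=\sum_{n\ge0}c(n,3,a,b)z^n$ be the unique formal power series with $f_3=1+azf_3+bz^3f_3^2$, and $d_1^{(3)}(N,a,b)=\det\big(c(i+j+1,3,a,b)\big)_{i,j=0}^{N-1}$. Then $$d_1^{(3)}(3n,a,b)=(-1)^nb^{3n^2}\ (n\ge0),\qquad d_1^{(3)}(3n+1,a,b)=(-1)^n(n+1)ab^{3n^2+2n}\ (n\ge0),$$ $$d_1^{(3)}(3n-1,a,b)=(-1)^{n-1}nab^{3n^2-2n}\ (n\ge1).$$
   Context: The determinant of a $0\times0$ matrix is $1$. *)

(* Defs.v *)
From mathcomp Require Import all_boot all_order all_algebra.
Set Implicit Arguments.
Unset Strict Implicit.
Unset Printing Implicit Defensive.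
Import GRing.Theory.
Local Open Scope ring_scope.

(* A formal power series is its coefficient sequence; equality of series is
   pointwise equality [=1]. *)
Definition fps (K : nzRingType) := nat -> K.

Section FormalPowerSeries.
Variable K : nzRingType.
Implicit Types (f g : fps K) (a b : K).

Definition fps_one : fps K := fun n => (n == 0%N)%:R.
Definition fps_zpow (k : nat) : fps K := fun n => (n == k)%:R.
Definition fps_add f g : fps K := fun n => f n + g n.
Definition fps_scale a f : fps K := fun n => a * f n.
Definition fps_mul f g : fps K := fun n => \sum_(i < n.+1) f i * g (n - i)%N.

(* 1 + a z f + b z^3 f^2 *)
Definition f3_rhs a b f : fps K :=
  fps_add fps_one
    (fps_add (fps_scale a (fps_mul (fps_zpow 1) f))
             (fps_scale b (fps_mul (fps_zpow 3) (fps_mul f f)))).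

Definition is_f3 a b f : Prop := f =1 f3_rhs a b f.

Definition d1 (c : fps K) (N : nat) : K :=
  \det (\matrix_(i < N, j < N) c (i + j + 1)%N).

Lemma fps_mul_zpow_local k f g n :
  (forall i, (i < n)%N -> f i = g i) ->
  fps_mul (fps_zpow k.+1) f n = fps_mul (fps_zpow k.+1) g n.
Proof.
move=> fg; apply: eq_bigr => -[[|i] ltin] _ /=; first by rewrite !mul0r.
by rewrite fg // ltn_subrL /=; case: n ltin {fg}.
Qed.

Lemma f3_rhs_local a b f g n :
  (forall i, (i < n)%N -> f i = g i) -> f3_rhs a b f n = f3_rhs a b g n.
Proof.
move=> fg; rewrite /f3_rhs /fps_add /fps_scale (fps_mul_zpow_local _ fg).
congr (_ + (_ + _ * _)); apply: fps_mul_zpow_local => m ltmn.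
apply: eq_bigr => i _; rewrite !fg //.
  by apply: leq_ltn_trans ltmn; rewrite leq_subr.
by apply: leq_trans ltmn.
Qed.

(* Existence and uniqueness of the series f_3. *)
Lemma f3_exists_unique a b :
  exists2 f, is_f3 a b f & forall g, is_f3 a b g -> g =1 f.
Proof.
pose u m := iter m (f3_rhs a b) (fun=> 0).
have uS m p n : (n < m)%N -> u (m + p)%N n = u m n.
  elim: m n => // m IHm n ltnm; rewrite addSn; apply: f3_rhs_local => i ltin.
  by apply: IHm; apply: leq_trans ltin _.
pose f n := u n.+1 n.
have fE : is_f3 a b f.
  move=> n; rewrite /f -(uS _ 1%N) // addn1; apply: f3_rhs_local => i ltin.
  by rewrite -[LHS]/(u n.+1 i) -[n.+1](subnKC (leqW ltin)) uS.
exists f => // g gE; elim/ltn_ind => n IHn.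
by rewrite gE fE; apply: f3_rhs_local.
Qed.

End FormalPowerSeries.

(* Main.v *)
(** The Hankel kernel of a series [g] is [(g(x) - g(y)) / (x - y)], and
    multiplying a kernel by [g(x) g(y)] multiplies its [N]-th leading minor by
    [g(0) ^ (2 N)].  If [r g = 1], the kernel of [z^k g] is thus obtained from
    that of the pair [(z^k, r)], which is block diagonal: an anti-triangular
    [k x k] block, and the Hankel kernel of the tail of [- r] beyond [z^k].
    Here [r = 1 / f = 1 - a z - b z^3 f], so this tail is again [b] times a
    shift of [f], up to a corner entry [a] when [k = 0].  Hence, with [H k N]
    the minors of [z^k f],
    [H 1 (N + 3) = - b^(2 N + 2) H 1 N] and
    [H 0 (N + 3) = a b^(N + 2) H 1 (N + 2) - b^(2 N + 3) H 0 N]. *)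
Require Import Defs.
From mathcomp Require Import all_boot all_order all_algebra reals complex.
From mathcomp Require Import ring zify.
Set Implicit Arguments.
Unset Strict Implicit.
Unset Printing Implicit Defensive.
Import GRing.Theory.
Local Open Scope ring_scope.

Section CauchyProduct.
Variable K : nzRingType.
Implicit Types (p q r g : fps K).

Definition fps_trunc n p : {poly K} := \poly_(i < n) p i.

Lemma fps_mul_coef n p q i : (i < n)%N ->
  fps_mul p q i = (fps_trunc n p * fps_trunc n q)`_i.
Proof.
move=> lt_in; rewrite coefM; apply: eq_bigr => j _.
by rewrite !coef_poly !(leq_ltn_trans _ lt_in) ?leq_subr // -ltnS.
Qed.

Lemma fps_mulA p q r : fps_mul p (fps_mul q r) =1 fps_mul (fps_mul p q) r.
Proof.
move=> n; pose t := fps_trunc n.+1.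
have t_coef p' i : (i < n.+1)%N -> (t p')`_i = p' i by rewrite coef_poly => ->.
transitivity (t p * (t q * t r))`_n; last rewrite mulrA; rewrite coefM;
  apply: eq_bigr => i _; rewrite -(@fps_mul_coef n.+1) ?t_coef //;
  by rewrite ?ltn_ord ?ltnS ?leq_subr.
Qed.

Lemma fps_mulDl p q r :
  fps_mul (fps_add p q) r =1 fps_add (fps_mul p r) (fps_mul q r).
Proof.
by move=> n; rewrite /fps_add -big_split; apply: eq_bigr => i _; rewrite mulrDl.
Qed.

Lemma fps_mulZl s p q : fps_mul (fps_scale s p) q =1 fps_scale s (fps_mul p q).
Proof.
by move=> n; rewrite /fps_scale mulr_sumr; apply: eq_bigr => i _; rewrite mulrA.
Qed.

Lemma fps_mul_zpow k g n :
  fps_mul (fps_zpow K k) g n = if (n < k)%N then 0 else g (n - k)%N.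
Proof.
rewrite /fps_mul /fps_zpow; case: ltnP => [lt_nk | le_kn].
  by apply: big1 => i _; rewrite (ltn_eqF (leq_trans (ltn_ord i) lt_nk)) mul0r.
rewrite (bigD1 (Ordinal (le_kn : (k < n.+1)%N))) //= eqxx mul1r big1 ?addr0 //.
by move=> i /negPf; rewrite -val_eqE /= => ->; rewrite mul0r.
Qed.

Lemma fps_mul_zpow_addn k g n : fps_mul (fps_zpow K k) g (k + n)%N = g n.
Proof. by rewrite fps_mul_zpow ltnNge leq_addr addKn. Qed.

Lemma fps_mul_zpowD k l g n :
  fps_mul (fps_zpow K (k + l)%N) g (k + n)%N = fps_mul (fps_zpow K l) g n.
Proof. by rewrite !fps_mul_zpow ltn_add2l subnDl. Qed.

Lemma fps_mul1l g : fps_mul (fps_one K) g =1 g.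
Proof. exact: (fps_mul_zpow_addn 0). Qed.

End CauchyProduct.

Section LeadingMinors.
Variable K : comNzRingType.
Implicit Types (X Y : nat -> nat -> K) (r : fps K).

Definition lead_minor N X : K := \det (\matrix_(i < N, j < N) X i j).

Lemma eq_lead_minor N X Y : X =2 Y -> lead_minor N X = lead_minor N Y.
Proof. by move=> XY; congr (\det _); apply/matrixP=> i j; rewrite !mxE XY. Qed.

Lemma lead_minor_tr N X : lead_minor N (fun i j => X j i) = lead_minor N X.
Proof.
rewrite /lead_minor -det_tr.
by congr (\det _); apply/matrixP=> i j; rewrite !mxE.
Qed.

Lemma lead_minorZ N s X :
  lead_minor N (fun i j => s * X i j) = s ^+ N * lead_minor N X.
Proof.
by rewrite /lead_minor -detZ; congr (\det _); apply/matrixP=> i j; rewrite !mxE.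
Qed.

Lemma lead_minor_ublock k m X :
  (forall i j, (k <= i)%N -> (j < k)%N -> X i j = 0) ->
  lead_minor (k + m) X =
  lead_minor k X * lead_minor m (fun i j => X (k + i)%N (k + j)%N).
Proof.
move=> X0.
rewrite -(det_ublock _ (\matrix_(i < k, j < m) X i (k + j)%N)); congr (\det _).
apply/matrixP=> i j; rewrite mxE.
case: (split_ordP i) => i' ->; case: (split_ordP j) => j' ->;
  rewrite ?block_mxEul ?block_mxEur ?block_mxEdl ?block_mxEdr !mxE //=.
by rewrite X0 ?leq_addr.
Qed.

Lemma lead_minor_antitrig N X :
  (forall i j, (i + j + 1 < N)%N -> X i j = 0) ->
  lead_minor N X = (-1) ^+ 'C(N, 2) * \prod_(i < N) X i (N - i.+1)%N.
Proof.
elim: N X => [|N IHN] X X0.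
  by rewrite big_ord0 mulr1; exact: det_mx00.
rewrite [LHS](expand_det_row _ ord0) big_ord_recr /= big1 => [|j _]; last first.
  by rewrite mxE X0 ?mul0r //= addn1 ltnS ltn_ord.
rewrite add0r mxE /cofactor /= add0n.
have -> : \det (row' ord0 (col' ord_max (\matrix_(i < N.+1, j < N.+1) X i j))) =
    lead_minor N (fun i j => X i.+1 j).
  by congr (\det _); apply/matrixP=> i j; rewrite !mxE lift0 lift_max.
rewrite IHN => [|i j lt_ijN]; last by apply: X0; rewrite addSn.
by rewrite binS bin1 exprD big_ord_recl subn1 /=; ring.
Qed.

Lemma lead_minor_add_corner N X s :
  lead_minor N.+1 (fun i j => X i j + s * ((i == 0) && (j == 0))%:R) =
  lead_minor N.+1 X + s * lead_minor N (fun i j => X i.+1 j.+1).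
Proof.
pose E i j := if i == 0%N then (j == 0%N)%:R else X i j.
have -> : lead_minor N (fun i j => X i.+1 j.+1) = lead_minor N.+1 E.
  rewrite [RHS](expand_det_row _ ord0) big_ord_recl big1 => [|j _].
    rewrite mxE /E /= mul1r addr0 /cofactor expr0 mul1r.
    by congr (\det _); apply/matrixP=> i j; rewrite !mxE.
  by rewrite !mxE /E /= mul0r.
rewrite -[X in X + _]mul1r.
apply: (@determinant_multilinear _ _ _ _ _ ord0).
- by apply/rowP=> j; rewrite !mxE mul1r.
- by apply/matrixP=> i j; rewrite !mxE /= mulr0 addr0.
- by apply/matrixP=> i j; rewrite !mxE /= mulr0 addr0.
Qed.

(* The coefficients of r(x) X(x, y) and r(y) X(x, y). *)
Definition mulx r X (i j : nat) : K := fps_mul (X^~ j) r i.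
Definition muly r X (i j : nat) : K := fps_mul (X i) r j.

Lemma lead_minor_mulx r N X :
  lead_minor N (mulx r X) = r 0%N ^+ N * lead_minor N X.
Proof.
pose L : 'M[K]_N := \matrix_(i, k) (if (k <= i)%N then r (i - k)%N else 0).
have detL : \det L = r 0%N ^+ N.
  rewrite det_trig => [|]; last first.
    by apply/is_trig_mxP=> i j lt_ij; rewrite mxE leqNgt lt_ij.
  rewrite -[X in _ ^+ X](card_ord N) -prodr_const; apply: eq_bigr => i _.
  by rewrite mxE leqnn subnn.
rewrite /lead_minor -detL -det_mulmx; congr (\det _).
apply/matrixP=> i j; rewrite !mxE /mulx /fps_mul.
rewrite (big_ord_widen N (fun k => X k j * r (i - k)%N)) ?ltn_ord //.
rewrite big_mkcond; apply: eq_bigr => k _; rewrite !mxE ltnS.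
by case: ifP => _; rewrite ?mul0r // mulrC.
Qed.

Lemma lead_minor_muly r N X :
  lead_minor N (muly r X) = r 0%N ^+ N * lead_minor N X.
Proof. by rewrite -lead_minor_tr lead_minor_mulx lead_minor_tr. Qed.

End LeadingMinors.

Section Bezoutians.
Variable K : comNzRingType.
Implicit Types (p q r g : fps K) (X Y : nat -> nat -> K).

(* The coefficients of (x - y) X(x, y). *)
Definition diffxy X (i j : nat) : K :=
  (if i is i'.+1 then X i' j else 0) - (if j is j'.+1 then X i j' else 0).

Lemma diffxy_inj X Y : diffxy X =2 diffxy Y -> X =2 Y.
Proof.
move=> XY; elim=> [|i IHi] j.
  by have := XY 0%N j.+1; rewrite /diffxy !sub0r => /oppr_inj.
by have := XY i.+1 j.+1; rewrite /diffxy IHi => /addrI/oppr_inj.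
Qed.

Lemma diffxy_tr X i j : diffxy (fun i j => X j i) i j = - diffxy X j i.
Proof. by rewrite /diffxy opprB. Qed.

Lemma diffxy_mulx r X : diffxy (mulx r X) =2 mulx r (diffxy X).
Proof.
move=> i j; rewrite /diffxy /mulx /fps_mul.
under [RHS]eq_bigr do rewrite mulrBl.
rewrite sumrB; congr (_ - _).
  by case: i => [|i]; rewrite [RHS]big_ord_recl /= mul0r add0r ?big_ord0.
by case: j => [|j] //; rewrite big1 // => k _; rewrite mul0r.
Qed.

Lemma diffxy_muly r X : diffxy (muly r X) =2 muly r (diffxy X).
Proof.
move=> i j; rewrite -[LHS]opprK -diffxy_tr diffxy_mulx /mulx /muly /fps_mul.
by rewrite -sumrN; apply: eq_bigr => k _; rewrite diffxy_tr mulNr opprK.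
Qed.

(* X(x, y) = (p(x) q(y) - q(x) p(y)) / (x - y). *)
Definition bezoutian p q X : Prop :=
  diffxy X =2 fun i j => p i * q j - q i * p j.

Lemma bezoutian_mul p q r X : bezoutian p q X ->
  bezoutian (fps_mul p r) (fps_mul q r) (mulx r (muly r X)).
Proof.
move=> pqX i j; rewrite diffxy_mulx /mulx /fps_mul !big_distrlr -sumrB /=.
apply: eq_bigr => k _; rewrite diffxy_muly /muly /fps_mul big_distrl -sumrB /=.
by apply: eq_bigr => l _; rewrite pqX; ring.
Qed.

Lemma lead_minor_bezoutian_mul p q r X Y N :
  bezoutian p q X -> bezoutian (fps_mul p r) (fps_mul q r) Y ->
  lead_minor N Y = r 0%N ^+ (2 * N) * lead_minor N X.
Proof.
move=> /(bezoutian_mul r) prqrX prqrY.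
have /(eq_lead_minor N) -> : Y =2 mulx r (muly r X).
  by apply: diffxy_inj => i j; rewrite prqrX prqrY.
by rewrite lead_minor_mulx lead_minor_muly mulrA -exprD mul2n addnn.
Qed.

Lemma bezoutian_one g : bezoutian g (fps_one K) (fun i j => g (i + j).+1).
Proof.
by move=> [|i] [|j]; rewrite /diffxy /fps_one /= ?addn0 ?addnS; ring.
Qed.

(* The monomial r_m z^m of r contributes (x^k y^m - x^m y^k) / (x - y): the
   geometric sum of the x^i y^j with i + j + 1 = k + m, over i, j < k when
   m < k and, with a minus sign, over i, j >= k when m > k. *)
Lemma bezoutian_zpow k r :
  bezoutian (fps_zpow K k) r
    (fun i j => ((i < k)%N%:R - (k <= j)%N%:R) *
                fps_mul (fps_zpow K k) r (i + j).+1).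
Proof.
set s := fps_mul _ r; set X := fun i j => _ * s _; move=> i j.
have s_lt n : (n < k)%N -> s n = 0 by rewrite /s fps_mul_zpow => ->.
have coef_xX : (if i is i'.+1 then X i' j else 0) =
    ((i <= k)%N%:R - (k <= j)%N%:R) * s (i + j)%N.
  case: i => [|i] //; rewrite add0n.
  by case: (leqP k j) => [_|/s_lt ->]; rewrite ?subrr ?mul0r ?mulr0.
have coef_yX : (if j is j'.+1 then X i j' else 0) =
    ((i < k)%N%:R - (k < j)%N%:R) * s (i + j)%N.
  case: j {coef_xX} => [|j]; last by rewrite addnS.
  rewrite addn0.
  by case: (ltnP i k) => [/s_lt ->|_]; rewrite ?subrr ?mul0r ?mulr0.
have r_j : (i == k)%:R * r j = (i == k)%:R * s (i + j)%N.
  by case: eqP => [->|_]; rewrite ?mul0r // /s fps_mul_zpow_addn.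
have r_i : r i * (j == k)%:R = (j == k)%:R * s (i + j)%N.
  rewrite mulrC addnC.
  by case: eqP => [->|_]; rewrite ?mul0r // /s fps_mul_zpow_addn.
rewrite /fps_zpow r_j r_i /diffxy coef_xX coef_yX -!mulrBl; congr (_ * _).
by case: (ltngtP i k); case: (ltngtP j k) => _ _ /=; ring.
Qed.

End Bezoutians.

Section Hankel.
Variable K : comNzRingType.
Implicit Types (r g : fps K).

Definition hankel k g N : K :=
  lead_minor N (fun i j => fps_mul (fps_zpow K k) g (i + j).+1).

Lemma d1_hankel0 g N : d1 g N = hankel 0 g N.
Proof.
congr (\det _); apply/matrixP=> i j; rewrite !mxE addn1.
by rewrite -(fps_mul_zpow_addn 0 g).
Qed.

Lemma hankel_antitrig k g N : (N <= k)%N ->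
  hankel k g N = (-1) ^+ 'C(N, 2) * fps_mul (fps_zpow K k) g N ^+ N.
Proof.
move=> le_Nk; rewrite /hankel lead_minor_antitrig => [|i j lt_ijN]; last first.
  by rewrite fps_mul_zpow -addn1 (leq_trans lt_ijN).
congr (_ * _); rewrite -[X in _ = _ ^+ X](card_ord N) -prodr_const.
by apply: eq_bigr => i _; rewrite -addSn subnKC.
Qed.

Lemma hankel_inverse k m r g : fps_mul r g =1 fps_one K ->
  hankel k g (k + m) =
  g 0%N ^+ (2 * (k + m)) * ((-1) ^+ 'C(k, 2) * r 0%N ^+ k) *
  lead_minor m (fun i j => - r (k + (i + j)).+1).
Proof.
move=> rg1; have zpow_r0 : fps_mul (fps_zpow K k) r k = r 0%N.
  by rewrite -[X in fps_mul _ _ X]addn0 fps_mul_zpow_addn.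
rewrite -zpow_r0 -hankel_antitrig // -mulrA.
have zg_bez : bezoutian (fps_mul (fps_zpow K k) g) (fps_mul r g)
    (fun i j => fps_mul (fps_zpow K k) g (i + j).+1).
  by move=> i j; rewrite bezoutian_one !rg1.
rewrite /hankel (lead_minor_bezoutian_mul _ (bezoutian_zpow k r) zg_bez).
congr (_ * _); rewrite lead_minor_ublock => [|i j le_ki lt_jk]; last first.
  by rewrite ltnNge le_ki leqNgt lt_jk subrr mul0r.
congr (_ * _); last first.
  apply: eq_lead_minor => i j; rewrite ltnNge !leq_addr sub0r mulN1r.
  by rewrite addnACA -addnS -addnA fps_mul_zpow_addn addnS.
congr (\det _); apply/matrixP=> i j.
by rewrite !mxE ltn_ord leqNgt ltn_ord subr0 mul1r.
Qed.

End Hankel.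

Section F3.
Variables (K : comNzRingType) (a b : K) (c : fps K).
Hypothesis f3_c : is_f3 a b c.

Definition f3_inv : fps K :=
  fps_add (fps_one K)
    (fps_add (fps_scale (- a) (fps_zpow K 1))
             (fps_scale (- b) (fps_mul (fps_zpow K 3) c))).

Lemma f3_mul_inv : fps_mul f3_inv c =1 fps_one K.
Proof.
move=> n; rewrite fps_mulDl /fps_add fps_mulDl fps_mul1l /fps_add.
rewrite !fps_mulZl /fps_scale -fps_mulA {1}f3_c.
by rewrite /f3_rhs /fps_add /fps_scale; ring.
Qed.

Lemma f3_coef0 : c 0%N = 1.
Proof.
rewrite f3_c /f3_rhs /fps_add /fps_scale !fps_mul_zpow /fps_one /=.
by rewrite !mulr0 !addr0.
Qed.

Lemma f3_inv_coef n :
  f3_inv n = (n == 0)%N%:R - a * (n == 1)%N%:R - b * fps_mul (fps_zpow K 3) c n.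
Proof.
by rewrite /f3_inv /fps_add /fps_scale /fps_one /fps_zpow !mulNr addrA.
Qed.

Lemma f3_hankel_inverse k m : hankel k c (k + m) =
  (-1) ^+ 'C(k, 2) * lead_minor m (fun i j => - f3_inv (k + (i + j)).+1).
Proof.
rewrite (hankel_inverse k m f3_mul_inv) f3_coef0 f3_inv_coef fps_mul_zpow /=.
by rewrite !mulr0 !subr0 !expr1n mul1r mulr1.
Qed.

Lemma f3_hankel_pos k m : (0 < k <= 3)%N ->
  hankel k c (k + m) = (-1) ^+ 'C(k, 2) * b ^+ m * hankel (3 - k) c m.
Proof.
case/andP=> k_gt0 le_k3; rewrite f3_hankel_inverse -mulrA -lead_minorZ.
congr (_ * _); apply: eq_lead_minor => i j; rewrite -addnS.
rewrite -(fps_mul_zpowD k) subnKC // f3_inv_coef addnS.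
by case: k k_gt0 {le_k3} => //= k _; ring.
Qed.

Lemma f3_hankel0S m :
  hankel 0 c m.+1 = b ^+ m.+1 * hankel 3 c m.+1 + a * b ^+ m * hankel 1 c m.
Proof.
rewrite -[m.+1]add0n f3_hankel_inverse mul1r add0n -mulrA -!lead_minorZ.
pose X i j := b * fps_mul (fps_zpow K 3) c (i + j).+1.
have -> : lead_minor m (fun i j => b * fps_mul (fps_zpow K 1) c (i + j).+1) =
    lead_minor m (fun i j => X i.+1 j.+1).
  by apply: eq_lead_minor => i j; rewrite /X addnS -(fps_mul_zpowD 2 1).
rewrite -(lead_minor_add_corner m X); apply: eq_lead_minor => i j.
by rewrite /X f3_inv_coef add0n -addn_eq0 eqSS /=; ring.
Qed.

Lemma f3_hankel1_rec m : hankel 1 c m.+3 = - b ^+ (2 * m + 2) * hankel 1 c m.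
Proof.
have -> : (2 * m + 2 = m.+2 + m)%N by lia.
rewrite (f3_hankel_pos m.+2 (k := 1)) // (f3_hankel_pos m (k := 2)) // exprD.
ring.
Qed.

Lemma f3_hankel0_rec m : hankel 0 c m.+3 =
  a * b ^+ m.+2 * hankel 1 c m.+2 - b ^+ (2 * m + 3) * hankel 0 c m.
Proof.
have -> : (2 * m + 3 = m.+3 + m)%N by lia.
by rewrite f3_hankel0S (f3_hankel_pos m (k := 3)) // exprD; ring.
Qed.

Lemma f3_hankel1_mul3_add s n : hankel 1 c (3 * n + s) =
  (-1) ^+ n * b ^+ (3 * n ^ 2 + 2 * s * n - n) * hankel 1 c s.
Proof.
elim: n => [|n IHn]; first by rewrite !muln0 !mul1r.
have -> : (3 * n.+1 + s = (3 * n + s).+3)%N by lia.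
have -> : (3 * n.+1 ^ 2 + 2 * s * n.+1 - n.+1 =
    2 * (3 * n + s) + 2 + (3 * n ^ 2 + 2 * s * n - n))%N by nia.
by rewrite f3_hankel1_rec IHn [in RHS]exprD [(-1) ^+ n.+1]exprS; ring.
Qed.

Lemma f3_hankel0_mul3_addS s n : hankel 0 c (3 * n + s).+1 =
  (-1) ^+ n * b ^+ (3 * n ^ 2 + 2 * s.+1 * n) *
  (hankel 0 c s.+1 + n%:R * a * b ^+ s * hankel 1 c s).
Proof.
elim: n => [|n IHn]; first by rewrite !muln0 !mul1r !mul0r addr0.
have -> : ((3 * n.+1 + s).+1 = (3 * n + s).+1.+3)%N by lia.
rewrite f3_hankel0_rec IHn.
have -> : ((3 * n + s).+3 = 3 * n.+1 + s)%N by lia.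
rewrite f3_hankel1_mul3_add; set E := (3 * n.+1 ^ 2 + 2 * s.+1 * n.+1)%N.
have bE_hom : b ^+ E = b ^+ (2 * (3 * n + s).+1 + 3) *
    b ^+ (3 * n ^ 2 + 2 * s.+1 * n).
  by rewrite -exprD; congr (_ ^+ _); rewrite /E; nia.
have bE_inhom : b ^+ E * b ^+ s = b ^+ (3 * n.+1 + s) *
    b ^+ (3 * n.+1 ^ 2 + 2 * s * n.+1 - n.+1).
  by rewrite -!exprD; congr (_ ^+ _); rewrite /E; nia.
transitivity ((-1) ^+ n.+1 * a * (b ^+ E * b ^+ s) * hankel 1 c s +
    (-1) ^+ n.+1 * b ^+ E *
    (hankel 0 c s.+1 + n%:R * a * b ^+ s * hankel 1 c s)).
  by rewrite bE_inhom bE_hom [(-1) ^+ n.+1]exprS; ring.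
by rewrite -(natr1 n); ring.
Qed.

Lemma f3_hankel1_init :
  [/\ hankel 1 c 0 = 1, hankel 1 c 1 = 1 & hankel 1 c 2 = 0].
Proof.
rewrite (f3_hankel_pos 1 (k := 1)) // !hankel_antitrig //=.
by rewrite !fps_mul_zpow /= f3_coef0 !(expr0, expr1, mulr0, mulr1).
Qed.

Lemma f3_hankel0_init :
  [/\ hankel 0 c 1 = a, hankel 0 c 2 = a * b & hankel 0 c 3 = - b ^+ 3].
Proof.
have [h10 h11 h12] := f3_hankel1_init.
rewrite f3_hankel0_rec !f3_hankel0S h10 h11 h12 !hankel_antitrig //.
by rewrite !fps_mul_zpow /=; split; ring.
Qed.

Lemma f3_d1_mul3 n : d1 c (3 * n) = (-1) ^+ n * b ^+ (3 * n ^ 2).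
Proof.
rewrite d1_hankel0; case: n => [|n]; first by rewrite hankel_antitrig.
have [_ _ h12] := f3_hankel1_init; have [_ _ h03] := f3_hankel0_init.
rewrite mulnSr addn3 -addn2 f3_hankel0_mul3_addS h12 h03 mulr0 addr0.
have -> : (3 * n.+1 ^ 2 = 3 * n ^ 2 + 2 * 3 * n + 3)%N by nia.
by rewrite [in RHS]exprD [(-1) ^+ n.+1]exprS; ring.
Qed.

Lemma f3_d1_mul3_add1 n : d1 c (3 * n + 1) =
  (-1) ^+ n * (n + 1)%:R * a * b ^+ (3 * n ^ 2 + 2 * n).
Proof.
have [h10 _ _] := f3_hankel1_init; have [h01 _ _] := f3_hankel0_init.
rewrite d1_hankel0 addn1 -[(3 * n)%N]addn0 f3_hankel0_mul3_addS h10 h01.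
by rewrite natrD; ring.
Qed.

Lemma f3_d1_mul3_add2 n : d1 c (3 * n + 2) =
  (-1) ^+ n * n.+1%:R * a * b ^+ (3 * n.+1 ^ 2 - 2 * n.+1).
Proof.
have [_ h11 _] := f3_hankel1_init; have [_ h02 _] := f3_hankel0_init.
rewrite d1_hankel0 addn2 -addn1 f3_hankel0_mul3_addS h11 h02.
have -> : (3 * n.+1 ^ 2 - 2 * n.+1 = 3 * n ^ 2 + 2 * 2 * n + 1)%N by nia.
by rewrite [in RHS]exprD -(natr1 n); ring.
Qed.

End F3.

Theorem theorem6p2 (R : realType) (a b : R[i]) (c : fps R[i])
    (hc : is_f3 a b c) :
  [/\ forall n : nat, d1 c (3 * n) = (-1) ^+ n * b ^+ (3 * n ^ 2),
      forall n : nat,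
        d1 c (3 * n + 1) = (-1) ^+ n * (n + 1)%:R * a * b ^+ (3 * n ^ 2 + 2 * n)
    & forall n : nat, (1 <= n)%N ->
        d1 c (3 * n - 1) = (-1) ^+ (n - 1) * n%:R * a * b ^+ (3 * n ^ 2 - 2 * n)].
Proof.
split=> [n|n|[//|n] _].
- exact: f3_d1_mul3.
- exact: f3_d1_mul3_add1.
by rewrite mulnSr -addnBA // !subn1; exact: f3_d1_mul3_add2.
Qed.
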